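(* Let $\Delta > 0$ and $\nu \in [0,1)$ be real numbers. For $d \ge 0$ define $f(d,\nu,\Delta) = \rho_0(d, d+\Delta, \nu) - \overline{d}$, where $\overline{d} = d + \nu\Delta$. Then $$\lim_{d \to \infty} \bigl(d \cdot f(d,\nu,\Delta)\bigr) = \Delta^2\, \nu (1-\nu) \cdot \max(\nu, 1-\nu).$$
   Context: The function $\rho_0(d_1,d_2,\nu)$, for real $d_1,d_2$ and $0 \le \nu \le 1$, is defined by $$\rho_0(d_1,d_2,\nu) = \begin{cases} \frac{1}{2}\left[d_2 - d_1 \frac{1-\nu}{\nu} + \sqrt{4d_1^2 \frac{1-\nu}{\nu} + \left(d_2 - d_1 \frac{1-\nu}{\nu}\right)^2}\,\right] & \text{if } \frac{d_1}{d_1+d_2} \le \nu \le 1,\\[2mm] \frac{1}{2}\left[d_1 - d_2 \frac{\nu}{1-\nu} + \sqrt{4d_2^2 \frac{\nu}{1-\nu} + \left(d_1 - d_2 \frac{\nu}{1-\nu}\right)^2}\,\right] & \text{if } 0 \le \nu < \frac{d_1}{d_1+d_2}.\end{cases}$$ (Only large $d$ matters for the limit, so the value of the formula at $d=0$ is irrelevant.) *)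

(* Defs.v *)
From Stdlib Require Import Reals.
From Coquelicot Require Import Coquelicot.

Open Scope R_scope.

(* Meaningful for 0 <= nu <= 1 and d1 + d2 <> 0.  The quotient (1 - nu) / nu
   is a genuine one whenever d1 / (d1 + d2) > 0, and nu / (1 - nu) whenever
   d1 / (d1 + d2) <= 1; elsewhere the value is an artefact of totality. *)
Definition rho0 (d1 d2 nu : R) : R :=
  if Rle_dec (d1 / (d1 + d2)) nu then
    / 2 * (d2 - d1 * ((1 - nu) / nu)
           + sqrt (4 * d1 ^ 2 * ((1 - nu) / nu)
                   + (d2 - d1 * ((1 - nu) / nu)) ^ 2))
  else
    / 2 * (d1 - d2 * (nu / (1 - nu))
           + sqrt (4 * d2 ^ 2 * (nu / (1 - nu))
                   + (d1 - d2 * (nu / (1 - nu))) ^ 2)).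

Definition dbar (d nu Delta : R) : R := d + nu * Delta.

Definition rho0_gap (d nu Delta : R) : R := rho0 d (d + Delta) nu - dbar d nu Delta.

(* Main.v *)
Require Import Defs.
From Stdlib Require Import Reals Lra.
From Coquelicot Require Import Coquelicot.

Open Scope R_scope.
Set Bullet Behavior "Strict Subproofs".

(** Both branches of [rho0] are the larger root of one quadratic.  With
    [q = (1 - mu) / mu], the branch is the larger root of
    [X ^ 2 - (y - x * q) * X - x ^ 2 * q], where [(x, y, mu)] is
    [(d, d + Delta, nu)] in the first branch and [(d + Delta, d, 1 - nu)] in
    the second; in both cases [dbar] is [x + mu * (y - x)].

    At [X = x + mu * (y - x)] the quadratic takes the value
    [- mu * (1 - mu) * (y - x) ^ 2], which does not depend on [x] once
    [y - x = delta] is fixed.  Rationalizing the square root therefore writes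
    the gap between the root and the mean as this constant divided by a
    quantity of order [x] ([larger_root_gap]).  After multiplication by [x], the
    result is a function of [/ x] that is continuous at [0]; since the
    discriminant tends to the perfect square [(1 + q) ^ 2] after scaling, the
    limit is [mu * (1 - mu) * delta ^ 2 / (1 + q)], and [1 / (1 + q) = mu]
    ([is_lim_larger_root_gap]).

    The threshold [d / (2 * d + Delta)] increases to [1 / 2] without reaching
    it.  Hence for large [d] the first branch applies exactly when
    [1 / 2 <= nu], so that [mu] is [Rmax nu (1 - nu)] in either case. *)

Definition larger_root (x y q : R) : R :=
  / 2 * (y - x * q + sqrt (4 * x ^ 2 * q + (y - x * q) ^ 2)).

(** The factor [x + c] multiplying the gap, rather than [x] alone, is for the
    second branch of [rho0]: there the root is governed by [x = d + Delta]
    while the gap is multiplied by [d = x - Delta].  The denominator is positive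
    because [x > Rabs delta] dominates the term [(2 * mu - 1) * delta]. *)
Lemma larger_root_gap (mu delta c x : R) :
  0 < mu <= 1 -> Rabs delta < x ->
  (x + c) * (larger_root x (x + delta) ((1 - mu) / mu) - (x + mu * delta)) =
  2 * (1 + c * / x) * (mu * (1 - mu) * delta ^ 2) /
  (sqrt (4 * ((1 - mu) / mu) + (1 + delta * / x - (1 - mu) / mu) ^ 2)
   + (1 + (1 - mu) / mu) + (2 * mu - 1) * delta * / x).
Proof.
intros Hmu Hx.
assert (Hx0 : 0 < x) by (generalize (Rabs_pos delta); lra).
set (q := (1 - mu) / mu).
assert (Hq : 0 <= q).
{ unfold q; apply Rmult_le_pos; [lra | left; apply Rinv_0_lt_compat; lra]. }
assert (Hqmu : mu * q = 1 - mu) by (unfold q; field; lra).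
set (D := 4 * q + (1 + delta * / x - q) ^ 2).
assert (HD : 0 <= D).
{ unfold D; generalize (pow2_ge_0 (1 + delta * / x - q)); lra. }
assert (Hsqrt : sqrt (4 * x ^ 2 * q + (x + delta - x * q) ^ 2) = x * sqrt D).
{ replace (4 * x ^ 2 * q + (x + delta - x * q) ^ 2) with (x ^ 2 * D)
    by (unfold D; field; lra).
  rewrite sqrt_mult; [| apply pow2_ge_0 | exact HD].
  now rewrite sqrt_pow2 by lra. }
unfold larger_root; rewrite Hsqrt.
assert (HS : sqrt D ^ 2 = D) by (now apply pow2_sqrt).
assert (HS0 : 0 <= sqrt D) by apply sqrt_pos.
set (S := sqrt D) in *.
set (den := S + (1 + q) + (2 * mu - 1) * delta * / x).
assert (Hdenx : 0 < x * den).
{ replace (x * den) with (x * S + x * q + (x + (2 * mu - 1) * delta))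
    by (unfold den; field; lra).
  assert (0 <= x * S) by (apply Rmult_le_pos; lra).
  assert (0 <= x * q) by (apply Rmult_le_pos; lra).
  apply Rabs_def2 in Hx.
  nra. }
assert (Hden : den <> 0) by (intro E; rewrite E in Hdenx; lra).
apply (Rmult_eq_reg_r (x * den)); [| lra].
(* the conjugate product, where the terms of degree 2 and 1 in [x] cancel *)
assert (Hconj :
  (/ 2 * (x + delta - x * q + x * S) - (x + mu * delta)) * (x * den)
  = 2 * (mu * (1 - mu) * delta ^ 2)).
{ replace (x * den) with (x * S + x * (1 + q) + (2 * mu - 1) * delta)
    by (unfold den; field; lra).
  transitivity (/ 2 * (x ^ 2 * S ^ 2
                       - (x * (1 + q) + (2 * mu - 1) * delta) ^ 2)).
  { field. }
  rewrite HS.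
  replace (x ^ 2 * D) with (4 * x ^ 2 * q + (x + delta - x * q) ^ 2)
    by (unfold D; field; lra).
  transitivity (2 * (mu * (1 - mu) * delta ^ 2)
                + 2 * x * delta * (1 - mu - mu * q)).
  { field. }
  rewrite Hqmu; ring. }
rewrite Rmult_assoc, Hconj.
field; lra.
Qed.

Lemma is_lim_larger_root_gap (mu delta c : R) :
  0 < mu <= 1 ->
  is_lim (fun x => (x + c) * (larger_root x (x + delta) ((1 - mu) / mu)
                              - (x + mu * delta)))
    p_infty (delta ^ 2 * mu * (1 - mu) * mu).
Proof.
intros Hmu.
set (q := (1 - mu) / mu).
assert (Hq : 1 + q = / mu) by (unfold q; field; lra).
assert (Hqpos : 0 < 1 + q) by (rewrite Hq; apply Rinv_0_lt_compat; lra).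
set (num := fun t => 2 * (1 + c * t) * (mu * (1 - mu) * delta ^ 2)).
set (den := fun t => sqrt (4 * q + (1 + delta * t - q) ^ 2)
                     + (1 + q) + (2 * mu - 1) * delta * t).
assert (Hden0 : den 0 = 2 * / mu).
{ unfold den.
  replace (4 * q + (1 + delta * 0 - q) ^ 2) with ((1 + q) ^ 2) by ring.
  rewrite sqrt_pow2 by lra; rewrite Hq; ring. }
assert (Hinv : 0 < / mu) by (rewrite <- Hq; exact Hqpos).
apply (is_lim_ext_loc (fun x => num (/ x) / den (/ x))).
{ exists (Rabs delta); intros x Hx; symmetry.
  now apply larger_root_gap. }
replace (delta ^ 2 * mu * (1 - mu) * mu) with (num 0 / den 0)
  by (rewrite Hden0; unfold num; field; lra).
apply (is_lim_comp_continuous Rinv (fun t => num t / den t) p_infty 0).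
- apply (is_lim_inv (fun x => x) p_infty p_infty); [apply is_lim_id | easy].
- apply (ex_derive_continuous (fun t => num t / den t)).
  unfold num, den; auto_derive; repeat split; try lra.
  + replace (4 * q + _) with ((1 + q) ^ 2) by ring.
    now apply pow_lt.
  + change (den 0 <> 0); rewrite Hden0; lra.
Qed.

Theorem theorem5p1 (Delta nu : R) (hDelta : 0 < Delta) (hnu : 0 <= nu < 1) :
  is_lim (fun d : R => d * rho0_gap d nu Delta) p_infty
    (Finite (Delta ^ 2 * nu * (1 - nu) * Rmax nu (1 - nu))).
Proof.
destruct (Rle_lt_dec (/ 2) nu) as [Hnu | Hnu].
- rewrite Rmax_left by lra.
  apply (is_lim_ext_loc
    (fun d => (d + 0) * (larger_root d (d + Delta) ((1 - nu) / nu)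
                         - (d + nu * Delta)))).
  2: { apply is_lim_larger_root_gap; lra. }
  exists 0; intros d Hd.
  unfold rho0_gap, rho0, dbar, larger_root.
  destruct (Rle_dec _ _) as [_ | Hn]; [ring |].
  exfalso; apply Hn.
  apply Rle_div_l; nra.
- rewrite Rmax_right by lra.
  set (g := fun x => (x + - Delta) *
    (larger_root x (x + - Delta) ((1 - (1 - nu)) / (1 - nu))
     - (x + (1 - nu) * - Delta))).
  apply (is_lim_ext_loc (fun d => g (d + Delta))).
  + (* [d / (2 * d + Delta) > nu] amounts to
       [d * (1 - 2 * nu) > nu * Delta] *)
    exists (nu * Delta / (1 - 2 * nu)); intros d Hd.
    assert (Hd0 : 0 <= nu * Delta / (1 - 2 * nu)).
    { apply Rmult_le_pos; [nra | left; apply Rinv_0_lt_compat; lra]. }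
    apply Rlt_div_l in Hd; [| lra].
    unfold g, rho0_gap, rho0, dbar, larger_root.
    destruct (Rle_dec _ _) as [Hn | _].
    { exfalso; apply Rle_div_l in Hn; nra. }
    replace (d + Delta + - Delta) with d by ring.
    replace (1 - (1 - nu)) with nu by ring.
    ring.
  + replace (Delta ^ 2 * nu * (1 - nu) * (1 - nu)) with
      ((- Delta) ^ 2 * (1 - nu) * (1 - (1 - nu)) * (1 - nu)) by ring.
    apply (is_lim_comp g (fun d => d + Delta) p_infty _ p_infty).
    * apply is_lim_larger_root_gap; lra.
    * apply (is_lim_plus (fun d => d) (fun _ => Delta) p_infty p_infty Delta);
        [apply is_lim_id | apply is_lim_const | easy].
    * now exists 0.
Qed.
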